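(* Let $\Bbbk$ be a field, $n \in \mathbb{N}$, and $S := \Bbbk[x_0, x_1, \dotsc, x_n]$ with the standard grading. The Hilbert function of a finitely generated $\mathbb{N}$-graded $S$-module $M$ generated in degree zero satisfies, for all $j \in \mathbb{N}$, the following inequalities (in two equivalent forms): $$\frac{h_M(j)}{h_S(j)} \geq \frac{h_M(j+1)}{h_S(j+1)} \qquad \text{or} \qquad (n+j+1)\,h_M(j) \geq (j+1)\,h_M(j+1).$$
   Context: $\mathbb{N}$ is the set of non-negative integers. $S$ has the standard $\mathbb{N}$-grading with $\deg(x_i)=1$. The Hilbert function of a finitely generated $\mathbb{N}$-graded $S$-module $M$ is $h_M \colon \mathbb{N} \to \mathbb{N}$, $h_M(j) := \dim_{\Bbbk} M_j$. *)

(* Defs.v *)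
From Stdlib Require Import ClassicalEpsilon.
From HB Require Import structures.
From mathcomp Require Import all_boot all_order all_algebra.
From mathcomp Require Import mpoly.

Set Implicit Arguments.
Unset Strict Implicit.
Unset Printing Implicit Defensive.

Import Order.TTheory GRing.Theory Num.Theory.
Local Open Scope ring_scope.

Section GradedModules.
Variables (k : fieldType) (m : nat).
Local Notation S := {mpoly k[m]}.
Variable M : lmodType S.

Record is_grading (Mgr : nat -> M -> Prop) : Prop := IsGrading {
  grading0 : forall j, Mgr j 0;
  gradingB : forall j u v, Mgr j u -> Mgr j v -> Mgr j (u - v);
  gradingZ : forall i j (p : S) v,
    p \is i.-homog -> Mgr j v -> Mgr (i + j)%N (p *: v);
  grading_span : forall v, exists (N : nat) (c : nat -> M),
    (forall j, Mgr j (c j)) /\ v = \sum_(j < N) c j;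
  grading_direct : forall (N : nat) (c : nat -> M),
    (forall j, Mgr j (c j)) -> \sum_(j < N) c j = 0 ->
    forall j, (j < N)%N -> c j = 0
}.

Definition generates (G : M -> Prop) : Prop :=
  forall v, exists (r : nat) (g : 'I_r -> M) (p : 'I_r -> S),
    (forall i, G (g i)) /\ v = \sum_(i < r) p i *: g i.

Definition finitely_generated : Prop :=
  exists s : seq M, generates (fun v => v \in s).

(* [k] acts on [M] through the constant polynomials. *)
Definition is_kbasis (V : M -> Prop) (d : nat) (b : 'I_d -> M) : Prop :=
  (forall i, V (b i)) /\
  (forall v, V v ->
     exists! a : 'rV[k]_d, v = \sum_(i < d) (a 0 i)%:MP *: b i).

(* Arbitrary when [V] has no finite basis; by [kdim_eq] this is the number of
   elements of any finite basis of [V] otherwise. *)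
Definition kdim (V : M -> Prop) : nat :=
  epsilon (inhabits 0%N) (fun d => exists b : 'I_d -> M, is_kbasis V b).

Definition hilbert (Mgr : nat -> M -> Prop) (j : nat) : nat := kdim (Mgr j).

Lemma is_kbasis_leq (V : M -> Prop) d e (b : 'I_d -> M) (c : 'I_e -> M) :
  is_kbasis V b -> is_kbasis V c -> (d <= e)%N.
Proof.
move=> [Vb ub] [Vc uc].
have exA (i : 'I_d) : {a : 'rV[k]_e | b i = \sum_(l < e) (a 0 l)%:MP *: c l}.
  by apply: constructive_indefinite_description; have [a []] := uc _ (Vb i); exists a.
have exB (i : 'I_e) : {a : 'rV[k]_d | c i = \sum_(l < d) (a 0 l)%:MP *: b l}.
  by apply: constructive_indefinite_description; have [a []] := ub _ (Vc i); exists a.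
pose A : 'M[k]_(d, e) := \matrix_i sval (exA i).
pose B : 'M[k]_(e, d) := \matrix_i sval (exB i).
suff AB : A *m B = 1%:M.
  have := mxrankM_maxl A B; rewrite AB mxrank1 => /leq_trans; apply.
  exact: rank_leq_col.
apply/row_matrixP => i.
have [a [_ ua]] := ub _ (Vb i).
rewrite -(ua (row i 1%:M)); last first.
  rewrite (bigD1 i) //= big1 ?addr0 => [|l nli].
    by rewrite !mxE eqxx mpolyC1 scale1r.
  by rewrite !mxE eq_sym (negPf nli) mpolyC0 scale0r.
apply/esym/ua; rewrite [LHS](svalP (exA i)).
under eq_bigr => l _ do rewrite (svalP (exB l)) scaler_sumr.
rewrite exchange_big /=; apply: eq_bigr => j _.
rewrite !mxE rmorph_sum /= scaler_suml; apply: eq_bigr => l _.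
by rewrite scalerA -mpolyCM !mxE.
Qed.

Lemma kdim_eq (V : M -> Prop) d (b : 'I_d -> M) : is_kbasis V b -> kdim V = d.
Proof.
move=> bV; have [c cV] : exists c : 'I_(kdim V) -> M, is_kbasis V c.
  by apply: (epsilon_spec (inhabits 0%N) (fun d => exists b : 'I_d -> M, is_kbasis V b)); exists d, b.
by apply/eqP; rewrite eqn_leq (is_kbasis_leq cV bV) (is_kbasis_leq bV cV).
Qed.

End GradedModules.

Definition std_grading (k : fieldType) (m : nat) (j : nat)
    (p : {mpoly k[m]}^o) : Prop := (p : {mpoly k[m]}) \is j.-homog.

Lemma std_gradingP (k : fieldType) (m : nat) : is_grading (@std_grading k m).
Proof.
rewrite /std_grading; split.
- by move=> j; apply: dhomog0.
- by move=> j u v hu hv; apply: rpredB.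
- by move=> i j p v hp hv; apply: dhomogM.
- move=> p; exists (msize (p : {mpoly k[m]})), (fun j => pihomog mdeg j (p : {mpoly k[m]})); split.
    by move=> j; apply: pihomogP.
  exact: pihomog_partitionE.
- move=> N c hc h0 j jN.
  have := congr1 (pihomog mdeg j : {mpoly k[m]} -> {mpoly k[m]}) h0.
  rewrite raddf0 raddf_sum /= (bigD1 (Ordinal jN)) //= big1 ?addr0.
    by rewrite pihomog_dE.
  move=> l nlj; apply: (pihomog_ne0 _ (hc l)); exact: nlj.
Qed.

(* Main.v *)
(* Gröbner degeneration, reduced to linear algebra.  Let g_1, ..., g_r be finitely
   many degree-zero generators of M, order the terms x^m g_i lexicographically,
   and call a term standard if it is not a k-linear combination of smaller terms
   of the same degree.  The standard terms of degree j form a basis of M_j, and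
   multiplying a linear relation by a variable shows that dividing a standard
   term by a variable leaves a standard term.  Now sum the exponents of all
   standard terms of degree j+1: each term contributes j+1, while a standard term
   x^m g_i of degree j is reached from x^m x_l g_i with weight m_l + 1, hence
   contributes at most n+1+j in total. *)
Require Import Defs.
From Stdlib Require Import ClassicalEpsilon.
From HB Require Import structures.
From mathcomp Require Import all_boot all_order all_algebra.
From mathcomp Require Import mpoly.

Set Implicit Arguments.
Unset Strict Implicit.

Import Order.TTheory GRing.Theory Num.Theory.
Local Open Scope ring_scope.

(** * Spans and independence of indexed families *)

Section LinearCombinations.
Variables (R : nzRingType) (V : lmodType R).

Definition in_span (I : Type) (s : seq I) (v : I -> V) (u : V) : Prop :=
  exists c : I -> R, u = \sum_(i <- s) c i *: v i.

Definition independent (I : eqType) (s : seq I) (v : I -> V) : Prop :=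
  forall c : I -> R, \sum_(i <- s) c i *: v i = 0 -> {in s, forall i, c i = 0}.

Lemma in_span0 (I : Type) (s : seq I) v : in_span s v 0.
Proof. by exists (fun=> 0); rewrite big1 // => i _; rewrite scale0r. Qed.

Lemma in_spanD (I : Type) (s : seq I) v x y :
  in_span s v x -> in_span s v y -> in_span s v (x + y).
Proof.
move=> [c ->] [e ->]; exists (fun i => c i + e i).
by rewrite -big_split; apply: eq_bigr => i _; rewrite scalerDl.
Qed.

Lemma in_spanZ (I : Type) (s : seq I) v a x : in_span s v x -> in_span s v (a *: x).
Proof.
move=> [c ->]; exists (fun i => a * c i).
by rewrite scaler_sumr; apply: eq_bigr => i _; rewrite scalerA.
Qed.

Lemma in_span_sum (I J : Type) (s : seq I) v (r : seq J) (P : pred J) (F : J -> V) :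
  (forall j, P j -> in_span s v (F j)) -> in_span s v (\sum_(j <- r | P j) F j).
Proof. by move=> H; elim/big_ind: _ => //; [exact: in_span0|exact: in_spanD]. Qed.

Lemma in_span_mem (I : eqType) (s : seq I) v i : uniq s -> i \in s -> in_span s v (v i).
Proof.
move=> us si; exists (fun l => (l == i)%:R).
rewrite (bigD1_seq i) //= eqxx scale1r big1 ?addr0 // => l /negPf ->.
by rewrite scale0r.
Qed.

Lemma in_span_trans (I J : eqType) (s : seq I) (r : seq J) v w u :
  {in s, forall i, in_span r w (v i)} -> in_span s v u -> in_span r w u.
Proof.
move=> H [c ->]; rewrite big_seq; apply: in_span_sum => i si.
exact/in_spanZ/H.
Qed.

End LinearCombinations.

(** Supplies a decreasing measure: the order on indices need not be well-founded, but only finitely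
    many entries of a list lie below, or above, a given index. *)
Lemma size_filter_lt (T : eqType) (a b : pred T) (s : seq T) x :
  subpred a b -> x \in s -> b x -> ~~ a x ->
  (size [seq y <- s | a y] < size [seq y <- s | b y])%N.
Proof.
move=> ab xs bx ax; rewrite !size_filter -(size_filter b).
rewrite -(count_predC a [seq y <- s | b y]).
rewrite count_filter (eq_count (a1 := predI a b) (a2 := a)) => [|y /=].
  rewrite -[ltnLHS]addn0 ltn_add2l -has_count; apply/hasP; exists x => //.
  by rewrite mem_filter bx.
by case ay: (a y); rewrite //= ab.
Qed.

(** * Extracting a basis from a finite ordered family *)

Section StandardIndices.
Variables (K : fieldType) (V : lmodType K) (d : Order.disp_t) (I : orderType d).
Variables (v : I -> V) (s : seq I).
Hypothesis us : uniq s.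

(** Classical choice turns an undecidable property into a boolean, so that it can filter a list. *)
Definition standard (i : I) : bool :=
  excluded_middle_informative (~ in_span [seq l <- s | (l < i)%O] v (v i)).

Lemma standardPn i :
  reflect (in_span [seq l <- s | (l < i)%O] v (v i)) (~~ standard i).
Proof.
rewrite /standard; case: excluded_middle_informative => h /=; constructor=> //.
exact: NNPP.
Qed.

Lemma in_span_standard i : i \in s -> in_span [seq l <- s | standard l] v (v i).
Proof.
have [N] := ubnP (size [seq l <- s | (l < i)%O]).
elim: N i => // N IH i lN si.
have [st|/standardPn] := boolP (standard i).
  by apply: in_span_mem; rewrite ?filter_uniq // mem_filter st.
apply: in_span_trans => l; rewrite mem_filter => /andP[li sl]; apply: IH => //.
rewrite -ltnS (leq_trans _ lN) // ltnS.
by apply: (size_filter_lt (x := l)); rewrite ?ltxx // => x /lt_trans; apply.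
Qed.

(** The largest index with a nonzero coefficient would be a combination of smaller ones, against
    standardness; hence the induction descends from the top of [s]. *)
Lemma independent_standard : independent [seq l <- s | standard l] v.
Proof.
move=> c c0 i; have [N] := ubnP (size [seq l <- s | (i < l)%O]).
elim: N i => // N IH i lN; rewrite mem_filter => /andP[st si].
have [//|ci] := eqVneq (c i) 0.
suff /standardPn : in_span [seq l <- s | (l < i)%O] v (v i) by rewrite st.
(* Solve the relation for [v i]. The [if] extends [c] by zero, since the span runs over all smaller
   indices, standard or not; indices above [i] drop out by induction. *)
exists (fun l => - (c i)^-1 * (if standard l then c l else 0)).
move: c0; rewrite (bigD1_seq i) ?filter_uniq ?mem_filter ?st //=.
rewrite big_filter_cond => /(congr1 (fun x => (c i)^-1 *: x)).
rewrite scaler0 scalerDr scalerA mulVf // scale1r => /eqP.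
rewrite addr_eq0 => /eqP ->.
under [RHS]eq_bigr do rewrite -scalerA scaleNr.
rewrite sumrN -scaler_sumr; congr (- (_ *: _)).
rewrite big_filter big_seq_cond [RHS]big_seq_cond.
rewrite big_mkcond [RHS]big_mkcond; apply: eq_bigr => l _.
case sl: (l \in s) => //=; case stl: (standard l) => /=; last first.
  by rewrite scale0r if_same.
have [//|il|->//] := ltgtP l i.
rewrite (IH l) ?scale0r // ?mem_filter ?stl ?sl //.
rewrite -ltnS (leq_trans _ lN) // ltnS.
by apply: (size_filter_lt (x := l)); rewrite ?ltxx // => x /(lt_trans il).
Qed.

End StandardIndices.

(** * Double counting of exponents *)

Section MonomialCount.
Variables (T : eqType) (n : nat).
Implicit Types A B : seq (T * 'X_{1..n}).

(** Division by the variable [l] maps the members of [A] with positive exponent injectively into [B]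
    and lowers that exponent by one; the other members of [A] contribute zero. *)
Lemma sum_exponents_leq A B (l : 'I_n) : uniq A -> uniq B ->
  (forall i m, (i, m + U_(l))%MM \in A -> (i, m) \in B) ->
  (\sum_(p <- A) p.2 l <= \sum_(q <- B) (q.2 l).+1)%N.
Proof.
move=> uA uB AB; pose down (p : T * 'X_{1..n}) := (p.1, (p.2 - U_(l))%MM).
have downK (p : T * 'X_{1..n}) : p.2 l != 0%N ->
    p = ((down p).1, ((down p).2 + U_(l))%MM).
  by case: p => i m /= ml; rewrite submK // lep1mP.
pose D := [seq p : T * 'X_{1..n} <- A | p.2 l != 0%N].
have -> : (\sum_(p <- A) p.2 l = \sum_(q <- map down D) (q.2 l).+1)%N.
  rewrite big_map big_filter (bigID (fun p : T * 'X_{1..n} => p.2 l == 0%N)) /=.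
  rewrite big1 => [|p /eqP //]; rewrite add0n; apply: eq_bigr => p pl.
  by rewrite mnmBE mnm1E eqxx subn1 prednK // lt0n.
apply: (uniq_sub_le_big leqnn (fun x y => leq_addr y x)) => //.
- rewrite map_inj_in_uniq ?filter_uniq // => p q.
  rewrite !mem_filter => /andP[pl _] /andP[ql _] e.
  by rewrite (downK p pl) (downK q ql) e.
move=> _ /mapP[p + ->]; rewrite mem_filter => /andP[pl pA].
by apply: AB; rewrite -downK.
Qed.

(** Both sides are exponent sums over all variables, and the inequality already holds variable by
    variable. Here [n] is the number of variables. *)
Lemma order_ideal_count A B j : uniq A -> uniq B ->
  {in A, forall p, mdeg p.2 = j.+1} -> {in B, forall q, mdeg q.2 = j} ->
  (forall i m l, (i, m + U_(l))%MM \in A -> (i, m) \in B) ->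
  (j.+1 * size A <= (n + j) * size B)%N.
Proof.
move=> uA uB dA dB AB.
have -> : (j.+1 * size A = \sum_(p <- A) \sum_l p.2 l)%N.
  under eq_big_seq => p pA do rewrite -mdegE dA //.
  by rewrite big_const_seq count_predT iter_addn_0.
have -> : ((n + j) * size B = \sum_(q <- B) \sum_l (q.2 l).+1)%N.
  under eq_big_seq => q qB.
    under eq_bigr do rewrite -add1n.
    rewrite big_split /= sum1_card card_ord -mdegE dB //.
    over.
  by rewrite big_const_seq count_predT iter_addn_0.
rewrite exchange_big [leqRHS]exchange_big /=.
by apply: leq_sum => l _; apply: sum_exponents_leq => // i m; apply: AB.
Qed.

End MonomialCount.

(** * Monomials of a fixed degree *)

Definition monomials (n d : nat) : seq 'X_{1..n} :=
  [seq s2m (val t) | t : d.-tuple 'I_n <- enum (basis n d)].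

Lemma mem_monomials n d m : (m \in monomials n d) = (mdeg m == d).
Proof. by rewrite [RHS]basis_cover. Qed.

Lemma monomials_uniq n d : uniq (monomials n d).
Proof. exact: uniq_basis. Qed.

Lemma size_monomials n d : size (monomials n.+1 d) = 'C(d + n, d).
Proof. exact: size_basis. Qed.

Lemma dhomog_sum_monomials (R : nzRingType) n d (p : {mpoly R[n]}) :
  p \is d.-homog -> p = \sum_(m <- monomials n d) p@_m *: 'X_[m].
Proof.
move=> hp; apply/mpolyP => m; rewrite raddf_sum /=.
have [md|md] := boolP (m \in monomials n d).
  rewrite (bigD1_seq m) ?monomials_uniq //= mcoeffZ mcoeffX eqxx mulr1.
  by rewrite big1 ?addr0 // => l lm; rewrite mcoeffZ mcoeffX (negPf lm) mulr0.
rewrite (dhomog_nemf_coeff hp) -?mem_monomials // big_seq big1 // => l ld.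
by rewrite mcoeffZ mcoeffX (negPf (memPn md _ ld)) mulr0.
Qed.

(** * Restriction of scalars to [k], and dimension *)

Definition restrict_scalars (k : fieldType) n (M : lmodType {mpoly k[n]}) : Type := M.

Section RestrictScalars.
Variables (k : fieldType) (n : nat) (M : lmodType {mpoly k[n]}).
Local Notation Mk := (restrict_scalars M).

HB.instance Definition _ := GRing.Zmodule.on Mk.

(** Acts through constants exactly as in [is_kbasis], so linear algebra over this module computes
    [kdim]. *)
Let kscale (a : k) (v : Mk) : Mk := a%:MP *: (v : M).

Let kscaleA a b v : kscale a (kscale b v) = kscale (a * b) v.
Proof. by rewrite /kscale scalerA mpolyCM. Qed.

Let kscale1 : left_id 1 kscale.
Proof. by move=> v; rewrite /kscale mpolyC1 scale1r. Qed.

Let kscaleDr : right_distributive kscale +%R.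
Proof. by move=> a u v; rewrite /kscale scalerDr. Qed.

Let kscaleDl v : {morph kscale^~ v : a b / a + b}.
Proof. by move=> a b; rewrite /kscale mpolyCD scalerDl. Qed.

HB.instance Definition _ := GRing.Zmodule_isLmodule.Build k Mk
  kscaleA kscale1 kscaleDr kscaleDl.

Lemma restrict_scalarsE (a : k) (v : Mk) : a *: v = a%:MP *: (v : M).
Proof. by []. Qed.

Lemma kdim_span_independent (I : eqType) (s : seq I) (v : I -> Mk) (W : M -> Prop) :
  uniq s -> independent s v -> (forall u, W u <-> in_span s v u) -> kdim W = size s.
Proof.
move=> us fs Ws; pose t := tnth (in_tuple s).
have tI : injective t by apply/tuple_uniqP.
(* Converts row vectors into coefficient functions on [I]; as [t] is injective, the sum has at most
   one term. *)
pose ext (a : 'rV[k]_(size s)) x := \sum_(i | t i == x) a 0 i.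
have extE a i : ext a (t i) = a 0 i.
  by rewrite /ext (big_pred1 i) // => l; rewrite /= (inj_eq tI).
have sumE (a : 'rV[k]_(size s)) :
    \sum_(i < size s) (a 0 i)%:MP *: (v (t i) : M) = \sum_(x <- s) ext a x *: v x.
  by rewrite [RHS]big_tnth; apply: eq_bigr => i _; rewrite extE.
apply: (@kdim_eq _ _ _ _ _ (fun i => v (t i))); split.
  by move=> i; apply/Ws/in_span_mem; rewrite ?mem_tnth.
move=> u /Ws [c ->]; exists (\row_i c (t i)); split.
  by rewrite sumE big_tnth [RHS]big_tnth; apply: eq_bigr => i _; rewrite extE mxE.
move=> a; rewrite sumE => /eqP; rewrite -subr_eq0 -sumrB => /eqP e.
apply/rowP => i; rewrite mxE -extE; apply/eqP; rewrite -subr_eq0; apply/eqP.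
apply: (fs (fun x => c x - ext a x)); last exact: mem_tnth.
by rewrite -[RHS]e; apply: eq_bigr => x _; rewrite scalerBl.
Qed.

End RestrictScalars.

(** * Hilbert function of the polynomial ring *)

Lemma hilbert_std (k : fieldType) n j :
  hilbert (@std_grading k n.+1) j = 'C(j + n, j).
Proof.
rewrite -size_monomials.
pose v (m : 'X_{1..n.+1}) : restrict_scalars {mpoly k[n.+1]}^o := 'X_[m].
have vE c : \sum_(m <- monomials n.+1 j) c m *: v m =
    \sum_(m <- monomials n.+1 j) c m *: 'X_[m] :> {mpoly k[n.+1]}.
  by apply: eq_bigr => m _; apply: mul_mpolyC.
apply: (@kdim_span_independent _ _ _ _ _ v (@std_grading k n.+1 j)).
- exact: monomials_uniq.
- move=> c; rewrite vE => /(congr1 (fun p : {mpoly k[n.+1]} => mcoeff _ p)) c0.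
  move=> m ms; have := c0 m; rewrite mcoeff0 raddf_sum (bigD1_seq m) ?monomials_uniq //=.
  rewrite mcoeffZ mcoeffX eqxx mulr1 big1 ?addr0 // => l lm.
  by rewrite mcoeffZ mcoeffX (negPf lm) mulr0.
move=> p; split=> [/dhomog_sum_monomials e|[c ->]].
  by exists (fun m => mcoeff m (p : {mpoly k[n.+1]})); rewrite vE.
rewrite vE; rewrite /std_grading big_seq; apply: rpred_sum => m ms.
by apply: rpredZ; rewrite dhomogX -mem_monomials.
Qed.

(** The absorption identity for binomials; it links the two forms of the inequality. *)
Lemma hilbert_std_rec (k : fieldType) n j (h := hilbert (@std_grading k n.+1)) :
  (j.+1 * h j.+1 = (n.+1 + j) * h j)%N.
Proof.
rewrite /h !hilbert_std -mul_bin_diag addSn /=.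
by rewrite [(n.+1 + j)%N]addnC addnS.
Qed.

Lemma hilbert_std_gt0 (k : fieldType) n j : (0 < hilbert (@std_grading k n.+1) j)%N.
Proof. by rewrite hilbert_std bin_gt0 leq_addr. Qed.

(** * Graded modules and their standard terms *)

Section GradedModule.
Variables (k : fieldType) (n : nat) (M : lmodType {mpoly k[n]}).
Variable Mgr : nat -> M -> Prop.
Hypothesis gradedM : is_grading Mgr.

Lemma grading_sum j (I : Type) (s : seq I) (P : pred I) (F : I -> M) :
  (forall i, P i -> Mgr j (F i)) -> Mgr j (\sum_(i <- s | P i) F i).
Proof.
move=> MF; elim/big_ind: _ => // [|u v Mu Mv]; first exact: (grading0 gradedM).
rewrite -[v]opprK -[- v]sub0r; apply: (gradingB gradedM) => //.
exact/(gradingB gradedM)/Mv/(grading0 gradedM).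
Qed.

Lemma homogeneous_component N (c : nat -> M) j u :
  (forall d, Mgr d (c d)) -> Mgr j u -> (j < N)%N -> u = \sum_(d < N) c d ->
  u = c j.
Proof.
move=> Mc Mu jN e; apply/esym/eqP; rewrite -subr_eq0; apply/eqP.
(* Subtracting [u] in degree [j] gives a homogeneous family with sum zero, so its entry [c j - u]
   vanishes. *)
have := grading_direct gradedM (N := N) (c := fun d => c d - (if d == j then u else 0)).
move=> /(_ _ _ j jN); rewrite eqxx; apply.
  move=> d; apply: (gradingB gradedM) => //.
  by have [->|_] := eqVneq d j => //; apply: (grading0 gradedM).
rewrite sumrB -e -big_mkcond (big_pred1 (Ordinal jN)) ?subrr //.
Qed.

(** Each of the finitely many given generators involves only finitely many elements of degree [d];
    all of these together generate. *)
Lemma finite_homogeneous_generators d : finitely_generated M -> generates (Mgr d) ->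
  exists (r : nat) (g : 'I_r -> M), (forall i, Mgr d (g i)) /\
    forall u, in_span (enum 'I_r) g u.
Proof.
move=> [s gen_s] gen_d.
suff [r [g [Mg sg]]] : exists (r : nat) (g : 'I_r -> M), (forall i, Mgr d (g i)) /\
    {in s, forall u, in_span (enum 'I_r) g u}.
  exists r, g; split=> // u; have [l [h [p [hs ->]]]] := gen_s u.
  by apply: in_span_sum => i _; apply/in_spanZ/sg.
elim: s {gen_s} => [|u s [r [g [Mg sg]]]].
  by exists 0%N, (fun=> 0); split=> // -[].
have [q [h [p [Mh ->]]]] := gen_d u.
pose f (i : 'I_(q + r)) := match split i with inl i => h i | inr i => g i end.
have fl i : f (lshift r i) = h i by rewrite /f (unsplitK (inl i)).
have fr i : f (rshift q i) = g i by rewrite /f (unsplitK (inr i)).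
have f_span i : in_span (enum 'I_(q + r)) f (f i).
  by apply: in_span_mem; rewrite ?enum_uniq ?mem_enum.
exists (q + r)%N, f; split=> [i|w].
  by rewrite /f; case: split.
rewrite inE => /orP[/eqP->|/sg].
  by apply: in_span_sum => i _; apply: in_spanZ; rewrite -fl.
by apply: in_span_trans => i _; rewrite -fr.
Qed.

Section Generators.
Variables (r : nat) (g : 'I_r -> M).
Hypothesis Mg : forall i, Mgr 0%N (g i).
Hypothesis gen_g : forall u, in_span (enum 'I_r) g u.

(* The lexicographic order on pairs (generator, monomial) is compatible with
   multiplication by a monomial, which is what makes the set of standard pairs
   an order ideal. *)
Local Notation term := ('I_r *l 'X_{1..n})%type.

(** The target type makes combinations of terms have coefficients in [k], whereas those in [gen_g]
    are polynomials. *)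
Definition term_val (t : term) : restrict_scalars M := 'X_[t.2] *: g t.1.

Definition terms (j : nat) : seq term :=
  [seq (i, m) | i <- enum 'I_r, m <- monomials n j].

Lemma mem_terms j (t : term) : (t \in terms j) = (mdeg t.2 == j).
Proof.
case: t => i m; apply/allpairsP/idP => [[[i' m'] /= [_ ? [_ ->]]]|mj].
  by rewrite -mem_monomials.
by exists (i, m); rewrite mem_enum mem_monomials.
Qed.

Lemma terms_uniq j : uniq (terms j).
Proof.
by apply: allpairs_uniq; rewrite ?enum_uniq ?monomials_uniq // => -[? ?] [? ?].
Qed.

(** Since the generators have degree zero, only the degree-[j] parts of the polynomial coefficients
    of [u] matter. *)
Lemma graded_in_span_terms j u : Mgr j u <-> in_span (terms j) term_val u.
Proof.
split=> [Mu|[c ->]]; last first.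
  rewrite big_seq; apply: grading_sum => t; rewrite mem_terms => tj.
  rewrite restrict_scalarsE /term_val scalerA -[j]addn0.
  apply: (gradingZ gradedM) => //.
  by rewrite mul_mpolyC; apply: rpredZ; rewrite dhomogX.
have [p pu] := gen_g u.
(* Large enough to exceed [j] and to capture every homogeneous part of each [p i]. *)
pose N := (j + \sum_(i <- enum 'I_r) msize (p i)).+1.
have := @homogeneous_component N
  (fun d => \sum_(i <- enum 'I_r) pihomog mdeg d (p i) *: g i) j u.
move=> ->; rewrite ?ltnS ?leq_addr //; first last.
- rewrite exchange_big /= pu; apply: eq_big_seq => i ir.
  rewrite -scaler_suml -pihomog_partitionE //.
  by rewrite /N (big_rem i) //= addnCA -addnS leq_addr.
- move=> d; apply: grading_sum => i _; rewrite -{1}[d]addn0.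
  exact: (gradingZ gradedM (pihomogP mdeg d (p i)) (Mg i)).
exists (fun t : term => (pihomog mdeg j (p t.1))@_t.2).
rewrite big_allpairs; apply: eq_bigr => i _.
rewrite {1}(dhomog_sum_monomials (pihomogP mdeg j (p i))) scaler_suml.
apply: eq_bigr => m _.
by rewrite restrict_scalarsE /term_val /= scalerA mul_mpolyC.
Qed.

Local Notation std j := [seq t <- terms j | standard term_val (terms j) t].

Lemma hilbert_standard j : hilbert Mgr j = size (std j).
Proof.
apply: (kdim_span_independent (v := term_val)).
- by rewrite filter_uniq ?terms_uniq.
- exact/independent_standard/terms_uniq.
move=> u; rewrite graded_in_span_terms; split; apply: in_span_trans => t.
  exact/in_span_standard/terms_uniq.
rewrite mem_filter => /andP[_ tj].
by apply: in_span_mem; rewrite ?terms_uniq.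
Qed.

Lemma standard_divisor j i (m : 'X_{1..n}) l :
  ((i, (m + U_(l))%MM) : term) \in std j.+1 -> ((i, m) : term) \in std j.
Proof.
rewrite !mem_filter !mem_terms /= mdegD mdeg1 addn1 eqSS => /andP[+ ->].
rewrite andbT; apply: contraLR => /standardPn[c e]; apply/standardPn.
have -> : term_val (i, (m + U_(l))%MM) = 'X_l *: (term_val (i, m) : M).
  by rewrite /term_val /= scalerA -mpolyXD addmC.
rewrite e scaler_sumr big_seq; apply: in_span_sum => -[i' m'].
rewrite mem_filter mem_terms ltEprodlexi /= => /andP[lt_t m'j].
have -> : 'X_l *: (c (i', m') *: term_val (i', m') : M) =
    c (i', m') *: term_val (i', (m' + U_(l))%MM).
  rewrite !restrict_scalarsE /term_val /= !scalerA; congr (_ *: _).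
  by rewrite mpolyXD mulrAC mulrC; congr (_ * _); apply: mulrC.
apply/in_spanZ/in_span_mem; first by rewrite filter_uniq ?terms_uniq.
(* Adding [U_(l)] to both monomials keeps the lexicographic comparison and raises the degree to
   [j.+1]. *)
rewrite mem_filter mem_terms ltEprodlexi /= ltmc_add2l lt_t mdegD mdeg1 addn1.
by rewrite eqSS m'j.
Qed.

Lemma hilbert_growth j :
  (j.+1 * hilbert Mgr j.+1 <= (n + j) * hilbert Mgr j)%N.
Proof.
rewrite !hilbert_standard.
apply: order_ideal_count; rewrite ?filter_uniq ?terms_uniq //.
- by move=> t; rewrite mem_filter mem_terms => /andP[_ /eqP].
- by move=> t; rewrite mem_filter mem_terms => /andP[_ /eqP].
by move=> i m l; apply: standard_divisor.
Qed.

End Generators.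
End GradedModule.

Theorem theorem2p1 (k : fieldType) (n : nat) (M : lmodType {mpoly k[n.+1]})
    (Mgr : nat -> M -> Prop)
    (gradedM : is_grading Mgr)
    (fgM : finitely_generated M)
    (gen0M : generates (Mgr 0%N)) :
  let hM := hilbert Mgr in
  let hS := hilbert (@std_grading k n.+1) in
  forall j : nat,
    ((hM j)%:R / (hS j)%:R >= (hM j.+1)%:R / (hS j.+1)%:R :> rat) /\
    ((n + j + 1) * hM j >= (j + 1) * hM j.+1)%N.
Proof.
move=> hM hS j.
have [r [g [Mg gen_g]]] := finite_homogeneous_generators fgM gen0M.
have := hilbert_growth gradedM Mg gen_g j.
rewrite -/hM => growth; split; last by rewrite !addn1 -addSn.
rewrite ler_pdivrMr ?ltr0n ?hilbert_std_gt0 // mulrAC.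
rewrite ler_pdivlMr ?ltr0n ?hilbert_std_gt0 // -!natrM ler_nat.
(* With denominators cleared, the factor [j.+1] lets the recursion replace [hS j.+1] by a multiple
   of [hS j]; cancelling [hS j] leaves [growth]. *)
rewrite -(leq_pmul2l (ltn0Sn j)) mulnA mulnCA hilbert_std_rec.
by rewrite [leqRHS]mulnCA mulnA leq_mul2r growth orbT.
Qed.
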